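(* For every $n\ge 1$ the genus distribution of the Ringel ladder $RL_n$ is unimodal, and its peak $p_{RL}(n)$ is $$p_{RL}(n)=\begin{cases}\Big[\dfrac{n+1}{2}\Big], & 1\le n\le 6,\\[2mm] 3, & n=7,\\[1mm] \Big[\dfrac{n+2}{3}\Big]+1, & n\ge 8.\end{cases}$$
   Context: $[x]$ denotes the largest integer not exceeding $x$. The Ringel ladder $RL_n$ is the cubic graph with vertices $u_1,\dots,u_n,v_1,\dots,v_n,w,w'$ and edges $u_lu_{l+1}$, $v_lv_{l+1}$ ($1\le l\le n-1$), $u_lv_l$ ($1\le l\le n$), $wu_1$, $wv_1$, $w'u_n$, $w'v_n$ and $ww'$ (that is, the closed-end ladder with $n$ rungs whose two end edges are subdivided and the subdividing vertices joined by an edge). For a graph $G$, $g_i(G)$ is the number of 2-cell embeddings of $G$ on the orientable surface of genus $i$ (embeddings counted as rotation systems), and the genus distribution of $G$ is the sequence $g_\gamma(G),g_{\gamma+1}(G),\dots,g_{\gamma_M}(G)$ with $\gamma,\gamma_M$ the minimum and maximum genus of $G$. A finite sequence of nonnegative numbers $\{a_i\}_{i=q}^n$ is unimodal if $a_q\le\cdots\le a_{l-1}<a_l=\cdots=a_m>a_{m+1}\ge\cdots\ge a_n$ for some $q\le l\le m\le n$; if $l=m$, then $m$ is called the peak (indices are genera). *)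

(* Defs.v *)
From HB Require Import structures.
From mathcomp Require Import all_boot all_fingroup.

Set Implicit Arguments.
Unset Strict Implicit.
Unset Printing Implicit Defensive.

Record sgraph := SGraph {
  vertex :> finType;
  adj : rel vertex;
  adj_sym : symmetric adj;
  adj_irrefl : irreflexive adj }.

Definition edges (G : sgraph) : {set {set G}} :=
  [set [set p.1; p.2] | p : G * G & adj p.1 p.2].

(* A dart (x, y) is the edge xy oriented from x to y. *)
Definition dart (G : sgraph) : finType := {p : G * G | adj p.1 p.2}.

Definition tail (G : sgraph) (d : dart G) : G := (val d).1.

Lemma flip_subproof (G : sgraph) (d : dart G) : adj (val d).2 (val d).1.
Proof. by rewrite adj_sym (valP d). Qed.

Definition flip (G : sgraph) (d : dart G) : dart G :=
  exist (fun p : G * G => adj p.1 p.2)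
    ((val d).2, (val d).1) (flip_subproof d).

Lemma flip_inj (G : sgraph) : injective (@flip G).
Proof.
move=> d1 d2 /(congr1 val) /= [e2 e1].
by apply: val_inj; rewrite [LHS]surjective_pairing [RHS]surjective_pairing e1 e2.
Qed.

(* A rotation system prescribes a cyclic order of the darts leaving each
   vertex, i.e. it is a permutation of the darts whose cycles are exactly the
   sets of darts with a given tail. *)
Definition rotation_system (G : sgraph) (R : {perm dart G}) : bool :=
  [forall d, porbit R d == [set d' | tail d' == tail d]].

(* In MathComp, (s * t) x = t (s x): face tracing sends d to R (flip d). *)
Definition face_perm (G : sgraph) (R : {perm dart G}) : {perm dart G} :=
  (perm (@flip_inj G) * R)%g.

Definition faces (G : sgraph) (R : {perm dart G}) : nat :=
  #|porbits (face_perm R)|.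

(* Euler's formula V - E + F = 2 - 2i, without subtraction; it expresses the
   genus for connected graphs with at least one edge. *)
Definition has_genus (G : sgraph) (R : {perm dart G}) (i : nat) : bool :=
  #|G| + faces R + 2 * i == #|edges G| + 2.

(* g_i(G) *)
Definition genus_count (G : sgraph) (i : nat) : nat :=
  #|[set R : {perm dart G} | rotation_system R && has_genus R i]|.

Definition is_min_genus (G : sgraph) (q : nat) : Prop :=
  0 < genus_count G q /\ forall i, 0 < genus_count G i -> q <= i.

Definition is_max_genus (G : sgraph) (r : nat) : Prop :=
  0 < genus_count G r /\ forall i, 0 < genus_count G i -> i <= r.

(* a_q <= ... <= a_(l-1) < a_l = ... = a_m > a_(m+1) >= ... >= a_n, where a
   comparison with an index outside of [q, n] is dropped. *)
Definition unimodal_at (a : nat -> nat) (q n l m : nat) : Prop :=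
  q <= l <= m /\ m <= n /\
  [/\ forall i, q <= i -> i.+1 < l -> a i <= a i.+1,
      q < l -> a l.-1 < a l,
      forall i, l <= i <= m -> a i = a l,
      m < n -> a m.+1 < a m
    & forall i, m < i -> i < n -> a i.+1 <= a i].

Definition unimodal (a : nat -> nat) (q n : nat) : Prop :=
  exists l m, unimodal_at a q n l m.

Definition is_peak (a : nat -> nat) (q n p : nat) : Prop :=
  unimodal_at a q n p p.

Definition RL_vertex (n : nat) : finType := ('I_n + 'I_n + bool)%type.

Notation RL_u i := (inl (inl i)).
Notation RL_v i := (inl (inr i)).
Notation RL_w := (inr false).
Notation RL_w' := (inr true).

(* Each edge is listed in one direction. Rungs are numbered from 0, so that
   RL_u i stands for u_(i+1). *)
Definition RL_edge (n : nat) (x y : RL_vertex n) : bool :=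
  match x, y with
  | RL_u i, RL_u j => i.+1 == j
  | RL_v i, RL_v j => i.+1 == j
  | RL_u i, RL_v j => i == j
  | RL_w, RL_u i => i == 0 :> nat
  | RL_w, RL_v i => i == 0 :> nat
  | RL_w', RL_u i => i.+1 == n
  | RL_w', RL_v i => i.+1 == n
  | RL_w, RL_w' => true
  | _, _ => false
  end.

Definition RL_adj (n : nat) : rel (RL_vertex n) :=
  fun x y => RL_edge x y || RL_edge y x.

Lemma RL_adj_sym n : symmetric (@RL_adj n).
Proof. by move=> x y; rewrite /RL_adj orbC. Qed.

Lemma RL_adj_irrefl n : irreflexive (@RL_adj n).
Proof. by case=> [[i|i]|[]] //; rewrite /RL_adj /= gtn_eqF. Qed.

Definition ringel_ladder (n : nat) : sgraph :=
  SGraph (@RL_adj_sym n) (@RL_adj_irrefl n).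

Definition p_RL (n : nat) : nat :=
  if n <= 6 then (n + 1) %/ 2
  else if n == 7 then 3
  else (n + 2) %/ 3 + 1.

(* Main.v *)
Require Import Defs.
From mathcomp Require Import all_boot all_fingroup.
From mathcomp Require Import zify ring.

(* Choosing one of the two cyclic orders at each vertex identifies the rotation
   systems of a cubic graph with bit vectors, and faces with the cycles of a
   permutation of the darts. Cut the Ringel ladder between two rungs: the left
   part is only seen through the permutation of the three cut edges that its
   face boundaries induce, one of the six elements of S_3. Absorbing one more
   rung is a transfer map on these six states, whose counting recursions solve
   to
     g_i = 8^i D_i + (2^(n+i) - 8^(i-1)) D_(i-1),
     D_j = C(n-j, j) + C(n+1-j, j).
   With m = n - 2i the ratio D_i / D_(i-1) is an explicit rational function of
   m and i, which gives g_i < g_(i+1) for i <= m + 2, m >= 2 and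
   g_i > g_(i+1) for i >= m + 3, m >= 0; n <= 7 is a computation. *)

(** * The closed form and its monotonicity *)

(* D_j of the header. *)
Definition lucas_coef (n j : nat) : nat := 'C(n - j, j) + 'C(n.+1 - j, j).

(** Pascal's rule on each of the two binomials. When j > k the truncated subtractions make every
    binomial in [F] vanish. *)
Lemma lucas_coefS n j :
  lucas_coef n.+2 j.+1 = lucas_coef n.+1 j.+1 + lucas_coef n j.
Proof.
have F k : 'C(k.+2 - j.+1, j.+1) = 'C(k.+1 - j.+1, j.+1) + 'C(k - j, j).
  rewrite !subSS; case: (leqP j k) => jk; first by rewrite subSn ?binS.
  have -> : k.+1 - j = 0 by lia.
  have -> : k - j = 0 by lia.
  by case: j jk.
by rewrite /lucas_coef !F addnACA.
Qed.

Lemma lucas_coef0 n : lucas_coef n 0 = 2.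
Proof. by rewrite /lucas_coef !bin0. Qed.

Lemma lucas_coef_small n j : n.+1 < j.*2 -> lucas_coef n j = 0.
Proof. by move=> h; rewrite /lucas_coef !bin_small //; lia. Qed.

Lemma lucas_coef_gt0 n j : j.*2 <= n.+1 -> 0 < lucas_coef n j.
Proof. by move=> h; rewrite /lucas_coef addn_gt0 !bin_gt0; lia. Qed.

(* In terms of m = n - 2i, D_i = (m+i)! (2m+i+2) / (i! (m+1)!). *)
Lemma lucas_coef_fact m i :
  lucas_coef (m + i.*2) i * (i`! * m.+1`!) = (m + i)`! * (m.*2 + i + 2).
Proof.
rewrite /lucas_coef.
have -> : m + i.*2 - i = m + i by lia.
have -> : (m + i.*2).+1 - i = m.+1 + i by lia.
have E1 := @bin_fact (m + i) i (leq_addl _ _).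
have E2 := @bin_fact (m.+1 + i) i (leq_addl _ _).
rewrite addnK in E1; rewrite addnK addSn factS in E2.
rewrite mulnDl E2 factS.
have -> : 'C(m + i, i) * (i`! * (m.+1 * m`!)) = m.+1 * (m + i)`!.
  by rewrite -E1 (mulnCA i`!) mulnCA.
rewrite factS -mulnDl mulnC; congr (_ * _); lia.
Qed.

(** The quotient of the instances (m, i+1) and (m+2, i) of [lucas_coef_fact], which share the same
    n. *)
Lemma lucas_coef_ratio m i :
  (m + i + 2) * (m.*2 + i + 6) * i.+1 * lucas_coef (m + i.+1.*2) i.+1 =
  (m.*2 + i + 3) * (m + 3) * (m + 2) * lucas_coef (m + i.+1.*2) i.
Proof.
set n := m + i.+1.*2; rewrite -!muln2.
have E1 : lucas_coef n i.+1 * (i.+1 * i`! * (m.+1 * m`!)) =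
    (m + i).+1 * (m + i)`! * (m * 2 + i + 3).
  have := lucas_coef_fact m i.+1; rewrite -/n (addnS m i) !factS => ->.
  by congr (_ * _); lia.
have E2 : lucas_coef n i * (i`! * (m.+3 * (m.+2 * (m.+1 * m`!)))) =
    (m + i).+2 * ((m + i).+1 * (m + i)`!) * (m * 2 + i + 6).
  have := lucas_coef_fact m.+2 i.
  have -> : m.+2 + i.*2 = n by rewrite /n; lia.
  have -> : m.+2 + i = (m + i).+2 by [].
  by rewrite !factS => ->; congr (_ * _); lia.
(* After multiplication by this factor, the two sides contain the left sides of [E1] and [E2]
   respectively. *)
have K : 0 < i`! * m`! * (m.+1 * (m + i).+1) * (m + i)`!.
  by rewrite !muln_gt0 !fact_gt0.
apply/eqP; rewrite -(eqn_pmul2r K); apply/eqP.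
move: E1 E2; move: (i`!) (m`!) ((m + i)`!) (lucas_coef n i.+1) (lucas_coef n i).
move=> a b c X Y E1 E2.
transitivity (X * (i.+1 * a * (m.+1 * b)) * (m + i + 2) * (m * 2 + i + 6)
   * (m + i).+1 * c); first by ring.
rewrite E1.
transitivity (Y * (a * (m.+3 * (m.+2 * (m.+1 * b)))) * (m * 2 + i + 3) *
  c * (m + i).+1); last by ring.
by rewrite E2; ring.
Qed.

(* The subtraction truncates only where [lucas_coef n j] is 0. *)
Definition RL_genus (n i : nat) : nat :=
  if i is j.+1 then
    8 ^ i * lucas_coef n i + (2 ^ (n + i) - 8 ^ j) * lucas_coef n j
  else lucas_coef n 0.

Lemma expn2_8 m i : 2 ^ (m + 3 * i) = 2 ^ m * 8 ^ i.
Proof. by rewrite expnD expnM. Qed.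

(* With m = n - 2(i+1), [8 ^ i.+1] divides 8 times both terms, so comparing
   consecutive terms leaves only the factor 2^m. *)
Lemma RL_genus_gap m i (n := m + i.+1.*2) :
  8 * RL_genus n i.+1 =
    8 ^ i.+1 * (8 * lucas_coef n i.+1 + (8 * 2 ^ m - 1) * lucas_coef n i) /\
  8 * RL_genus n i.+2 =
    8 ^ i.+1 * (64 * lucas_coef n i.+2 + (16 * 2 ^ m - 8) * lucas_coef n i.+1).
Proof.
rewrite /RL_genus.
have -> : n + i.+1 = m + 3 * i.+1 by rewrite /n; lia.
have -> : n + i.+2 = m.+1 + 3 * i.+1 by rewrite /n; lia.
rewrite !expn2_8 !(expnS 8) (expnS 2).
move: (8 ^ i) (2 ^ m) (lucas_coef n i) (lucas_coef n i.+1) (lucas_coef n i.+2).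
move=> p e X Y Z; split; rewrite mulnDr mulnDr; congr (_ + _).
- by ring.
- rewrite mulnA mulnBr [in RHS]mulnA mulnBr; congr ((_ - _) * _); ring.
- by ring.
- rewrite mulnA mulnBr [in RHS]mulnA mulnBr; congr ((_ - _) * _); ring.
Qed.

Lemma lucas_coef_ratio_le m i a b (n := m + i.+1.*2) :
  a * ((m.*2 + i + 3) * (m + 3) * (m + 2)) <=
    b * ((m + i + 2) * (m.*2 + i + 6) * i.+1) ->
  a * lucas_coef n i.+1 <= b * lucas_coef n i.
Proof.
have := lucas_coef_ratio m i; rewrite -/n.
have P0 : 0 < (m + i + 2) * (m.*2 + i + 6) * i.+1 by rewrite !muln_gt0; lia.
move: P0; set P := _ * i.+1; set Q := _ * (m + 2) => P0 E h.
rewrite -(leq_pmul2l P0) mulnCA E (mulnA a) (mulnA P) (mulnC P b).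
exact: leq_mul.
Qed.

Lemma lucas_coef_ratio_ge m i a b (n := m + i.+1.*2) :
  b * ((m + i + 2) * (m.*2 + i + 6) * i.+1) <=
    a * ((m.*2 + i + 3) * (m + 3) * (m + 2)) ->
  b * lucas_coef n i <= a * lucas_coef n i.+1.
Proof.
have := lucas_coef_ratio m i; rewrite -/n.
have P0 : 0 < (m + i + 2) * (m.*2 + i + 6) * i.+1 by rewrite !muln_gt0; lia.
move: P0; set P := _ * i.+1; set Q := _ * (m + 2) => P0 E h.
rewrite -(leq_pmul2l P0) (mulnCA P a) E (mulnA a) (mulnA P) (mulnC P b).
exact: leq_mul.
Qed.

(* Equality at i = m + 2. *)
Lemma lucas_coef_drop m i (n := m + i.+1.*2) : m + 2 <= i ->
  (6 * m + 16) * lucas_coef n i.+1 <= (3 * m + 5) * lucas_coef n i.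
Proof.
move=> hi; apply: lucas_coef_ratio_le.
(* In terms of t the constant terms of the two sides agree, and the remaining coefficients compare
   termwise. *)
have [t ->] : exists t, i = m + 2 + t by exists (i - (m + 2)); lia.
rewrite -!muln2; nia.
Qed.

(** The ratio D_(i+1) / D_i is at least 1/2 + 1/(4m+12). Once D_(i+2) is dropped, a rise of
    [RL_genus] only needs it to exceed 1/2 + 7/(16(2^m - 1)), which follows when 2^m > 2m + 7. *)
Lemma lucas_coef_rise m i (n := m + i.+1.*2) : 3 <= m -> i <= m.+1 ->
  (2 * m + 7) * lucas_coef n i <= (4 * m + 12) * lucas_coef n i.+1.
Proof.
move=> hm hi; apply: lucas_coef_ratio_ge.
have [t Et] : exists t, m.+1 = i + t by exists (m.+1 - i); lia.
rewrite -!muln2.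
nia.
Qed.

Lemma expn2_ge m : 4 <= m -> 2 * m + 7 < 2 ^ m.
Proof.
elim: m => // m IH; rewrite leq_eqVlt => /orP[/eqP <- //|/IH].
by rewrite expnS; lia.
Qed.

Lemma RL_genus_rise m i (n := m + i.+1.*2) : 2 <= m -> i <= m.+1 ->
  RL_genus n i.+1 < RL_genus n i.+2.
Proof.
move=> hm hi; rewrite -(ltn_pmul2l (isT : 0 < 8)).
have [-> ->] := RL_genus_gap m i; rewrite -/n ltn_pmul2l ?expn_gt0 //.
have X0 : 0 < lucas_coef n i.+1 by rewrite lucas_coef_gt0 // /n; lia.
have [m4|] := leqP 4 m.
  have := lucas_coef_rise m i (ltnW m4) hi; rewrite -/n.
  have := expn2_ge m m4.
  move: X0; move: (2 ^ m) (lucas_coef n i) (lucas_coef n i.+1).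
  move=> e Y X X0 he h.
  nia.
(* Here m is 2 or 3 and i is at most m + 1, so finitely many cases remain. *)
rewrite /n {X0 n}; move: i m hm hi.
by case=> [|[|[|[|[|i]]]]] [|[|[|[|m]]]] // _ _; vm_compute.
Qed.

Lemma lucas_coef_half m i (n := m + i.+1.*2) : m + 2 <= i ->
  2 * lucas_coef n i.+1 <= lucas_coef n i.
Proof. by move/lucas_coef_drop; rewrite -/n; nia. Qed.

(** With X, Y, Z = D_(i+1), D_i, D_(i+2) and e = 2^m, the claim is 64 Z + (16e - 8) X < 8 X + (8e -
    1) Y; X is bounded by Y, and Z by X. *)
Lemma RL_genus_drop m i (n := m + i.+1.*2) : m + 2 <= i ->
  RL_genus n i.+2 < RL_genus n i.+1.
Proof.
move=> hi; rewrite -(ltn_pmul2l (isT : 0 < 8)).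
have [-> ->] := RL_genus_gap m i; rewrite -/n ltn_pmul2l ?expn_gt0 //.
have X0 : 0 < lucas_coef n i.+1 by rewrite lucas_coef_gt0 // /n; lia.
have XY := lucas_coef_drop m i hi; rewrite -/n in XY.
have [m3|m3] := leqP 3 m.
  have ZX := lucas_coef_half (m - 2) i.+1.
  rewrite (_ : m - 2 + _ = n) in ZX; last by rewrite /n; lia.
  have {}ZX := ZX ltac:(lia).
  (* With 2Z <= X the claim follows from (16e + 16) X < (8e - 1) Y; inserting [lucas_coef_drop]
     leaves exactly this bound, which is the expansion of [e2]. *)
  have e1 : 9 * m + 17 <= 8 * 2 ^ m.
    have [m4|] := leqP 4 m; first by have := expn2_ge m m4; lia.
    by move=> ?; have -> : m = 3 by lia.
  move: X0 XY ZX e1; move: (2 ^ m) => e.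
  move: (lucas_coef n i) (lucas_coef n i.+1) (lucas_coef n i.+2) => Y X Z.
  move=> X0 XY ZX e1.
  have Y0 : 0 < Y by nia.
  have XY' : (3 * m + 8) * ((16 * e + 16) * X) <= (8 * e + 8) * (3 * m + 5) * Y.
    by rewrite -mulnA; apply: leq_trans (leq_mul (leqnn _) XY); rewrite leq_eqVlt;
      apply/orP; left; apply/eqP; ring.
  have e2 : (8 * e + 8) * (3 * m + 5) < (3 * m + 8) * (8 * e - 1) by nia.
  have le : (16 * e + 16) * X < (8 * e - 1) * Y.
    rewrite -(@ltn_pmul2l (3 * m + 8)) ?addn_gt0 ?orbT //.
    by apply: leq_ltn_trans XY' _; rewrite mulnA ltn_pmul2r.
  nia.
(* The bound 9m + 17 <= 8 2^m fails for m <= 2, but there D_(i+2) is much smaller: it is 0 for m = 0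
   and 1 for m = 1, and the ratio formula serves m = 2. *)
have ZX : 8 * lucas_coef n i.+2 <= lucas_coef n i.+1.
  case: m m3 @n hi X0 XY => [|[|[|//]]] _ n hi X0 XY.
  - by rewrite [lucas_coef n i.+2]lucas_coef_small // /n; lia.
  - have -> : lucas_coef n i.+2 = 1.
      rewrite /lucas_coef /n.
      have -> : (1 + i.+1.*2) - i.+2 = i.+1 by lia.
      have -> : (1 + i.+1.*2).+1 - i.+2 = i.+2 by lia.
      by rewrite binn bin_small.
    rewrite /lucas_coef /n.
    have -> : 1 + i.+1.*2 - i.+1 = i.+2 by lia.
    have -> : (1 + i.+1.*2).+1 - i.+1 = i.+3 by lia.
    by rewrite (binS i.+2) !binSn; lia.
  - rewrite -(mul1n (lucas_coef n i.+1)).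
    have -> : n = 0 + i.+2.*2 by rewrite /n; lia.
    by apply: lucas_coef_ratio_le; nia.
move: X0 XY ZX; move: (lucas_coef n i) (lucas_coef n i.+1) (lucas_coef n i.+2).
move=> Y X Z X0 XY ZX.
by case: m m3 {hi n} XY => [|[|[|//]]] _ XY; lia.
Qed.

Lemma RL_genus_lt_succ n i : 8 <= n -> 3 * i <= n + 2 ->
  RL_genus n i < RL_genus n i.+1.
Proof.
case: i => [|i] n8 hi.
  rewrite /RL_genus addn1 expn0 !lucas_coef0.
  have e : 1 < 2 ^ n by rewrite (ltn_exp2l 0) //; lia.
  by rewrite (expnS 2 n); lia.
(* The hypothesis 8 <= n ensures m = n - 2(i+1) >= 2; for n = 7 and i + 1 = 3 this would fail. *)
have En : n = (n - i.+1.*2) + i.+1.*2 by lia.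
by rewrite En RL_genus_rise //; lia.
Qed.

Lemma RL_genus_gt_succ n i : n + 3 <= 3 * i -> i.*2 <= n ->
  RL_genus n i.+1 < RL_genus n i.
Proof.
case: i => [|i] hi hn; first by lia.
have En : n = (n - i.+1.*2) + i.+1.*2 by lia.
by rewrite En RL_genus_drop //; lia.
Qed.

(** For n >= 8 the value of [p_RL] is the least i with 3i > n + 2, exactly where the rise ends and
    the drop begins. *)
Lemma RL_genus_monotone n : 1 <= n ->
  (forall i, i < p_RL n -> RL_genus n i < RL_genus n i.+1) /\
  (forall i, p_RL n <= i < (n + 2) %/ 2 -> RL_genus n i.+1 < RL_genus n i).
Proof.
move=> n1; have [n8|n8] := leqP 8 n.
  have -> : p_RL n = (n + 2) %/ 3 + 1.
    by rewrite /p_RL; case: ifP => [|_]; [lia | case: ifP => [|_]; [lia|]].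
  split=> i hi; first by apply: RL_genus_lt_succ => //; lia.
  by apply: RL_genus_gt_succ; lia.
have small : all (fun n =>
    all (fun i => RL_genus n i < RL_genus n i.+1) (iota 0 (p_RL n)) &&
    all (fun i => RL_genus n i.+1 < RL_genus n i)
      (iota (p_RL n) ((n + 2) %/ 2 - p_RL n))) (iota 1 7).
  by vm_compute.
move/allP/(_ n): small; rewrite mem_iota => /(_ ltac:(lia)) /andP[/allP h1 /allP h2].
split=> i hi; first by apply: h1; rewrite mem_iota.
by apply: h2; rewrite mem_iota; lia.
Qed.

Lemma RL_genus_eq0 n i : (n + 2) %/ 2 < i -> RL_genus n i = 0.
Proof.
case: i => // i hi; rewrite /RL_genus lucas_coef_small; last by lia.
(* In the borderline case n + 1 = 2i the coefficient D_i is not 0, but its factor 2^(3i) - 8^i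
   is. *)
have [hn|hn] : n.+1 = i.*2 \/ n.+1 < i.*2 by lia.
  have -> : n + i.+1 = 3 * i by lia.
  by rewrite expnM subnn muln0.
by rewrite lucas_coef_small // !muln0.
Qed.

Lemma RL_genus_max_gt0 n : 0 < RL_genus n ((n + 2) %/ 2).
Proof.
have -> : (n + 2) %/ 2 = (n %/ 2).+1 by lia.
rewrite /RL_genus addn_gt0 !muln_gt0 subn_gt0 (@lucas_coef_gt0 n (n %/ 2));
  last by lia.
have e8 : 8 ^ (n %/ 2) = 2 ^ (3 * (n %/ 2)) by rewrite expnM.
rewrite andbT e8 ltn_exp2l //.
by apply/orP; right; lia.
Qed.

Lemma unimodal_at_strict (a : nat -> nat) q n p : q <= p <= n ->
  (forall i, q <= i < p -> a i < a i.+1) ->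
  (forall i, p <= i < n -> a i.+1 < a i) -> unimodal_at a q n p p.
Proof.
move=> /andP[qp pn] up down; split; first by rewrite qp leqnn.
split=> //; split.
- by move=> i qi ip; apply/ltnW/up; lia.
- move=> qp'; have -> : a p = a p.-1.+1 by rewrite prednK //; lia.
  by apply: up; lia.
- by move=> i /andP[pi ip]; congr a; lia.
- by move=> pn'; apply: down; lia.
- by move=> i pi iN; apply/ltnW/down; lia.
Qed.

Lemma RL_genus_unimodal n : 1 <= n ->
  unimodal_at (RL_genus n) 0 ((n + 2) %/ 2) (p_RL n) (p_RL n).
Proof.
move=> n1; have [up down] := RL_genus_monotone n n1.
apply: unimodal_at_strict => [|i /andP[_]|//]; last exact: up.
rewrite leq0n /p_RL; case: (leqP n 6) => n6; first by lia.
by case: eqVneq => [->|n7] //; lia.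
Qed.

(** * The recursion satisfied by the closed form *)

Lemma RL_genusSE n j :
  RL_genus n j.+1 + 8 ^ j * lucas_coef n j =
  8 ^ j.+1 * lucas_coef n j.+1 + 2 ^ (n + j.+1) * lucas_coef n j.
Proof.
rewrite /RL_genus -addnA -mulnDl; congr (_ + _).
have [nj|nj] := leqP j.*2 n.+1; last by rewrite lucas_coef_small // !muln0.
by rewrite subnK // (_ : 8 ^ j = 2 ^ (3 * j)) ?leq_exp2l ?expnM //; lia.
Qed.

(** This is twice the recursion [count_faces_turn_rec] of the face counts, reindexed by genus. *)
Lemma RL_genus_rec n j :
  RL_genus n.+2 j.+1 =
  RL_genus n.+1 j.+1 + 2 ^ (n.+2 + j) * lucas_coef n.+1 j + 8 * RL_genus n j.
Proof.
have E1 := RL_genusSE n.+2 j; have E2 := RL_genusSE n.+1 j.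
rewrite lucas_coefS in E1.
rewrite (_ : n.+2 + j.+1 = (n + j).+3) in E1; last by lia.
rewrite (_ : n.+1 + j.+1 = (n + j).+2) in E2; last by lia.
rewrite (_ : n.+2 + j = (n + j).+2); last by lia.
case: j E1 E2 => [|j] E1 E2.
  rewrite [RL_genus n 0]lucas_coef0 !lucas_coef0 in E1 E2 *.
  by rewrite !(expnS _ _.+1) expn0 expn1 in E1 E2 *; lia.
have E3 := RL_genusSE n j; rewrite lucas_coefS in E1.
rewrite (_ : n + j.+1 = (n + j).+1) in E1 E2 E3 *; last by lia.
rewrite !(expnS 2) !(expnS 8) in E1 E2 E3 *; move: E1 E2 E3.
move: (2 ^ _) (8 ^ _) => p e.
move: (RL_genus _ _) (RL_genus _ _) (RL_genus _ _) => x y z.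
move: (lucas_coef _ _) (lucas_coef _ _) (lucas_coef _ _) (lucas_coef _ _).
move=> a b c d E1 E2 E3.
rewrite ?(mulnDl, mulnDr) in E1 E2 E3 *; lia.
Qed.

Set Implicit Arguments.
Unset Strict Implicit.
Unset Printing Implicit Defensive.

(** * Cycles of a function *)

(** Taken for plain functions, so that face tracing maps can be unfolded by computation;
    [cycles_perm] relates it to [porbits]. *)
Definition cycles (T : finType) (f : T -> T) : nat :=
  #|[set [set y | fconnect f x y] | x : T]|.

Lemma fconnectP (T : finType) (f : T -> T) x y :
  reflect (exists i, y = iter i f x) (fconnect f x y).
Proof.
apply: (iffP idP) => [/iter_findex <-|[i ->]]; last exact: fconnect_iter.
by exists (findex f x y).
Qed.

Lemma eq_cycles (T : finType) (f g : T -> T) : f =1 g -> cycles f = cycles g.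
Proof.
move=> fg; congr #|pred_of_set _|; apply: eq_imset => x.
by apply/setP => y; rewrite !inE (eq_fconnect fg).
Qed.

Lemma cycles_perm (T : finType) (s : {perm T}) : #|porbits s| = cycles s.
Proof.
congr #|pred_of_set _|; apply: eq_imset => x; apply/setP => y; rewrite inE.
apply/porbitP/fconnectP => -[i ->]; exists i; first by rewrite -permX.
by rewrite permX.
Qed.

Lemma cycles_conj (T U : finType) (h : T -> U) (f : T -> T) (g : U -> U) :
  bijective h -> (forall x, h (f x) = g (h x)) -> cycles f = cycles g.
Proof.
move=> bh hf; have ih := bij_inj bh.
have hi i x : h (iter i f x) = iter i g (h x).
  by elim: i => //= i IH; rewrite hf IH.
have hF x : h @: [set y | fconnect f x y] = [set z | fconnect g (h x) z].
  case: bh => k hk kh; apply/setP => z; rewrite inE -(kh z) mem_imset // inE.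
  apply/fconnectP/fconnectP => -[i e]; exists i; first by rewrite e hi.
  by apply: ih; rewrite hi.
rewrite /cycles -(card_imset _ (imset_inj ih)) -imset_comp.
rewrite (eq_imset _ hF) (imset_comp (fun u => [set z | fconnect g u z])).
congr #|pred_of_set _|; apply/setP => X; case: bh => k hk kh.
apply/imsetP/imsetP => -[u _ ->]; first by exists u.
by exists u; rewrite // -(kh u) imset_f.
Qed.

Lemma cycles_comp (T : finType) (f g : T -> T) :
  bijective g -> cycles (fun x => f (g x)) = cycles (fun x => g (f x)).
Proof. by move=> bg; apply: cycles_conj bg _. Qed.

(** Deletes x from its cycle without changing the type: the predecessor of x skips it, and x becomes
    a fixed point. *)
Definition bypass (T : finType) (x : T) (f : T -> T) (y : T) : T :=
  if y == x then x else if f y == x then f x else f y.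

Lemma bypassE (T : finType) (f : T -> T) (fI : injective f) x :
  bypass x f =1 (perm fI * tperm x (f x))%g.
Proof.
move=> y; rewrite permM permE /bypass.
case: eqVneq => [->|yx]; first by rewrite tpermR.
case: eqVneq => [->|fyx]; first by rewrite tpermL.
by rewrite tpermD // eq_sym // (inj_eq fI).
Qed.

Lemma bypass_inj (T : finType) (f : T -> T) x :
  injective f -> injective (bypass x f).
Proof. by move=> fI; apply: eq_inj perm_inj _ => y; rewrite (bypassE fI). Qed.

(** A bypass is a product with the transposition of x and f x; as both lie in one cycle, it splits x
    off, unless x was already fixed. *)
Lemma cycles_bypass (T : finType) (f : T -> T) x :
  injective f -> cycles (bypass x f) = cycles f + (f x != x).
Proof.
move=> fI; rewrite (eq_cycles (bypassE fI x)).
have -> : cycles f = cycles (perm fI) by apply: eq_cycles => y; rewrite permE.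
(* The two products are conjugate; [porbits_mul_tperm] wants the transposition on the left. *)
have E : cycles (perm fI * tperm x (f x))%g = cycles (tperm x (f x) * perm fI)%g.
  transitivity (cycles (fun y => tperm x (f x) (perm fI y))).
    by apply: eq_cycles => y; rewrite permM.
  transitivity (cycles (fun y => perm fI (tperm x (f x) y))).
    by rewrite cycles_comp //; exists (perm fI)^-1%g => y; rewrite ?permK ?permKV.
  by apply: eq_cycles => y; rewrite permM.
rewrite E -!cycles_perm.
have := porbits_mul_tperm (perm fI) x (f x).
have -> : x \in porbit (perm fI) (f x).
  by rewrite porbit_sym -[f x](permE fI) (mem_porbit _ 1).
by rewrite /= addn0 => ->; rewrite eq_sym.
Qed.

(** Discards the points of A once bypasses have made all of them fixed. *)
Lemma cycles_sum (A B : finType) (f : A + B -> A + B) (g : B -> B) :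
  (forall a, f (inl a) = inl a) -> (forall b, f (inr b) = inr (g b)) ->
  cycles f = #|A| + cycles g.
Proof.
move=> fA fB.
have iA i a : iter i f (inl a) = inl a by elim: i => //= i ->.
have iB i b : iter i f (inr b) = inr (iter i g b) by elim: i => //= i ->.
rewrite /cycles.
have -> : [set [set y | fconnect f x y] | x : A + B] =
    [set [set inl a] | a : A] :|: [set inr @: [set y | fconnect g b y] | b : B].
  have cA a : [set y | fconnect f (inl a) y] = [set inl a].
    apply/setP => y; rewrite !inE; apply/fconnectP/eqP => [[i ->]|->] //.
    by exists 0.
  have cB b : [set y | fconnect f (inr b) y] = inr @: [set y | fconnect g b y].
    apply/setP => y; rewrite inE; apply/fconnectP/imsetP.
      by case=> i ->; exists (iter i g b); rewrite ?inE ?fconnect_iter.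
    by case=> z; rewrite inE => /fconnectP[i ->] ->; exists i.
  apply/setP => X; rewrite in_setU; apply/imsetP/orP.
    case=> -[a|b] _ ->; [left|right]; first by rewrite cA imset_f.
    by rewrite cB; apply/imsetP; exists b.
  by case=> /imsetP[z _ ->]; [exists (inl z)|exists (inr z)].
rewrite cardsU disjoint_setI0.
  rewrite cards0 subn0 card_imset; last by move=> a b /set1_inj [].
  congr (_ + _); rewrite (imset_comp (fun X : {set B} => inr @: X)).
  by rewrite card_imset //; apply: imset_inj => ? ? [].
apply/pred0P => X /=; apply/negP => /andP[/imsetP[a _ ->] /imsetP[b _ /setP]].
move=> /(_ (inl a)); rewrite !inE eqxx => /esym/imsetP[] //.
Qed.

(** * Absorbing a rung *)

Notation slot := (option bool).

(** The two 3-cycles of the slots, that is the two rotations at a cubic vertex. *)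
Definition turn (b : bool) (s : slot) : slot :=
  match s with
  | Some false => if b then Some true else None
  | Some true => if b then None else Some false
  | None => Some (~~ b)
  end.

Definition mirror (s x : slot) : slot :=
  match s, x with
  | None, Some c => Some (~~ c)
  | None, None => None
  | Some b, Some c => if b == c then Some b else None
  | Some b, None => Some (~~ b)
  end.

(* The elements of S_3 acting on the slots: reflections, identity, 3-cycles. *)
Definition state : Type := (slot + option bool)%type.

Definition state_fun (t : state) : slot -> slot :=
  match t with
  | inl s => mirror s
  | inr (Some b) => turn b
  | inr None => id
  end.

(* New state and number of faces closed when a rung with bits [b1], [b2] is
   absorbed. *)
Definition rung_step (t : state) (b1 b2 : bool) : state * nat :=
  match t with
  | inr None => (inl None, 0)
  | inl None => if b1 == b2 then (inr None, 0) else (inl None, 1)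
  | inl (Some c) => (inr (Some (if c then b1 else ~~ b2)), 0)
  | inr (Some c) =>
      if b1 == b2 then (inl (Some (b1 == c)), 0)
      else if b1 == c then (inr (Some c), 1) else (inl None, 0)
  end.

(* The part of the graph that is not absorbed yet. Three of its edges are cut:
   the slots [Some false], [Some true] and [None] name the edges on the u-rail,
   on the v-rail and towards w'. [out d] is the other dart of the edge of [d],
   or the name of that edge if it is cut. At a rung vertex the same slots name
   the left dart, the right dart and the rung; at w and w' they name the darts
   to the u-rail, to the v-rail and along ww'. *)
Record network := Network {
  ndart :> finType;
  port : slot -> ndart;
  out : ndart -> slot + ndart;
  nrot : ndart -> ndart }.

(* Face tracing when the absorbed part sends cut edge [p] to cut edge [t p]. *)
Definition face_map (N : network) (t : slot -> slot) (d : N) : N :=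
  nrot (match out d with inl p => port N (t p) | inr d' => d' end).

Definition wf_network (N : network) : Prop :=
  [/\ forall d d' : N, out d = inr d' -> out d' = inr d,
      forall (d : N) p, out d = inl p -> d = port N p,
      forall p, out (port N p) = inl p
    & injective (@nrot N)].

Section AddRung.
Variables (N : network) (b1 b2 : bool).

Local Notation rdart := (bool * slot)%type.

(** The new rung stands to the left of [N]: its right darts are glued to the rail ports of [N], its
    left darts become the rail cuts, and the cut towards w' is kept. *)
Definition rung_port (s : slot) : (rdart + N)%type :=
  if s is Some b then inl (b, Some false) else inr (port N None).

Definition rung_out (d : (rdart + N)%type) : slot + (rdart + N)%type :=
  match d with
  | inl (b, Some false) => inl (Some b)
  | inl (b, Some true) => inr (inr (port N (Some b)))
  | inl (b, None) => inr (inl (~~ b, None))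
  | inr d => match out d with
             | inl (Some b) => inr (inl (b, Some true))
             | inl None => inl None
             | inr d' => inr (inr d')
             end
  end.

Definition rung_rot (d : (rdart + N)%type) : (rdart + N)%type :=
  match d with
  | inl (b, s) => inl (b, turn (if b then b2 else b1) s)
  | inr d => inr (nrot d)
  end.

Definition add_rung : network := Network rung_port rung_out rung_rot.
End AddRung.

Lemma turnK b : cancel (turn b) (turn (~~ b)).
Proof. by case: b => -[[]|]. Qed.

Lemma turn_inj b : injective (turn b).
Proof. exact: can_inj (turnK b). Qed.

Lemma state_fun_inj t : injective (state_fun t).
Proof. by case: t => [[[]|]|[[]|]] [[]|] [[]|]. Qed.

Lemma face_map_inj (N : network) (t : slot -> slot) :
  wf_network N -> injective t -> injective (face_map (N := N) t).
Proof.
move=> [oK op po rI] tI d1 d2 /rI.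
have pI : injective (port N) by move=> p q e; have := po p; rewrite e po => -[].
case E1: (out d1) => [p1|d1']; case E2: (out d2) => [p2|d2'].
- by move/pI/tI => e; rewrite (op _ _ E1) (op _ _ E2) e.
- by move=> e; move: (oK _ _ E2); rewrite -e po.
- by move=> e; move: (oK _ _ E1); rewrite e po.
- by move=> e; have := oK _ _ E1; rewrite e (oK _ _ E2) => -[].
Qed.

Lemma add_rung_wf (N : network) b1 b2 : wf_network N -> wf_network (add_rung N b1 b2).
Proof.
move=> [oK op po rI]; split.
- move=> [[b [[]|]]|d] //= [[b' s]|d'] //=.
  + by move=> [<-]; rewrite po.
  + by move=> [<- <-]; rewrite negbK.
  + by case E: (out d) => [[c|]|e] //= [<- <-]; rewrite (op _ _ E).
  + by case E: (out d) => [[c|]|e] //= [<-]; rewrite (oK _ _ E).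
- move=> [[b [[]|]]|d] //= p; first by move=> [<-].
  by case E: (out d) => [[c|]|e] //= [<-] /=; rewrite (op _ _ E).
- by case=> [b|] //=; rewrite po.
- by move=> [[b s]|d] [[c s']|d'] //= => [[<-] /turn_inj <-|[/rI ->]].
Qed.

(** Counts the successive bypasses along [l] that really split a cycle. *)
Fixpoint nontrivial (T : finType) (l : seq T) (f : T -> T) : nat :=
  if l is x :: l then (f x != x) + nontrivial l (bypass x f) else 0.

Lemma cycles_foldl_bypass (T : finType) (l : seq T) (f : T -> T) :
  injective f ->
  cycles (foldl (fun f x => bypass x f) f l) = cycles f + nontrivial l f.
Proof.
elim: l f => [|x l IH] f fI /=; first by rewrite addn0.
by rewrite IH; [rewrite cycles_bypass // addnA|apply: bypass_inj].
Qed.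

Definition rung_darts (B : Type) : seq ((bool * slot) + B) :=
  [:: inl (false, Some false); inl (false, Some true); inl (false, None);
      inl (true, Some false); inl (true, Some true); inl (true, None)].

Definition contract (N : network) (f : (bool * slot) + N -> (bool * slot) + N) :=
  foldl (fun f x => bypass x f) f (rung_darts N).

(* A bypass of a fixed point changes nothing: it accounts for a face closed
   inside the rung. *)
Lemma contract_rung (N : network) (t : state) b1 b2
    (f := face_map (N := add_rung N b1 b2) (state_fun t)) :
  [/\ forall a, contract f (inl a) = inl a,
      forall d : N,
        contract f (inr d) = inr (face_map (state_fun (rung_step t b1 b2).1) d)
    & nontrivial (rung_darts N) f + (rung_step t b1 b2).2 = 6].
Proof.
rewrite {}/f; case: N => N pN oN rN; split.
(* Six states times four bit pairs; the components of [N] remain variables, and tracing inside the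
   rung computes without knowing them. *)
- by case: t b1 b2 => [[[]|]|[[]|]] [] [] [[] [[]|]]; lazy; reflexivity.
- move=> d; case: t b1 b2 => [[[]|]|[[]|]] [] []; lazy;
    by case: (oN d) => [[[]|]|d'].
- by case: t b1 b2 => [[[]|]|[[]|]] [] []; lazy; reflexivity.
Qed.

(** Bypassing the six rung darts leaves six fixed points beside the face map of [N]. The cycle count
    grows only by the nontrivial bypasses, so the deficit from six is the number of faces closed. *)
Lemma cycles_add_rung (N : network) (t : state) b1 b2 : wf_network N ->
  cycles (face_map (N := add_rung N b1 b2) (state_fun t)) =
  (rung_step t b1 b2).2 + cycles (face_map (N := N) (state_fun (rung_step t b1 b2).1)).
Proof.
move=> wfN; have fI := face_map_inj (add_rung_wf b1 b2 wfN) (@state_fun_inj t).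
have [cA cN nt] := contract_rung N t b1 b2.
have := cycles_foldl_bypass (rung_darts N) fI.
rewrite -/(contract _) (cycles_sum cA cN) card_prod card_option card_bool.
move=> E; apply: (@addIn (nontrivial (rung_darts N)
  (face_map (N := add_rung N b1 b2) (state_fun t)))).
by rewrite -[LHS]E -[2 * 3]nt -addnA addnC.
Qed.

(** * Counting by faces *)

Lemma cycles_id (T : finType) (f : T -> T) : f =1 id -> cycles f = #|T|.
Proof.
move=> fid; rewrite (eq_cycles fid) /cycles -cardsT.
have -> : [set [set y | fconnect id x y] | x : T] = [set [set x] | x : T].
  apply: eq_imset => x; apply/setP => y; rewrite !inE.
  apply/fconnectP/eqP => [[i ->]|->]; last by exists 0.
  by elim: i.
by rewrite card_imset ?cardsT //; apply: set1_inj.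
Qed.

Definition slots : seq slot := [:: Some false; Some true; None].

Lemma cycles_slot (f : slot -> slot) : injective f ->
  foldl (fun f x => bypass x f) f slots =1 id ->
  cycles f + nontrivial slots f = 3.
Proof.
move=> fI /cycles_id; rewrite cycles_foldl_bypass // => ->.
by rewrite card_option card_bool.
Qed.

(** The vertex w' alone, with all three of its edges cut. *)
Definition end_net (b : bool) : network :=
  @Network (option bool) id inl (turn b).

Fixpoint bits (m : nat) : finType :=
  if m is m'.+1 then (bool * bool * bits m')%type : finType else bool.

Fixpoint ladder (m : nat) : bits m -> network :=
  if m is m'.+1 return bits m -> network then
    fun b => add_rung (ladder b.2) b.1.1 b.1.2
  else end_net.

Lemma ladder_wf m (b : bits m) : wf_network (ladder b).
Proof.
elim: m b => [|m IH] b; last by apply: add_rung_wf.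
by split=> //=; [move=> d p [] | exact: turn_inj].
Qed.

Definition count_faces (m : nat) (t : state) (c : nat) : nat :=
  \sum_(b : bits m) (cycles (face_map (N := ladder b) (state_fun t)) == c).

(** Multiplication of the face-counting polynomial by x^e, read on coefficients. *)
Definition shifted (e : nat) (f : nat -> nat) (c : nat) : nat :=
  if e <= c then f (c - e) else 0.

Lemma count_facesS m t c :
  count_faces m.+1 t c =
  \sum_(b1 : bool) \sum_(b2 : bool)
     shifted (rung_step t b1 b2).2 (count_faces m (rung_step t b1 b2).1) c.
Proof.
rewrite /count_faces pair_bigA /=.
rewrite -(pair_bigA _ (fun (p : bool * bool) (b : bits m) => nat_of_bool
  (cycles (face_map (N := add_rung (ladder b) p.1 p.2) (state_fun t)) == c))) /=.
apply: eq_bigr => -[b1 b2] _ /=; rewrite /shifted; case: ifP => ec.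
  apply: eq_bigr => b _; rewrite cycles_add_rung; last exact: ladder_wf.
  by congr nat_of_bool; apply/eqP/eqP; lia.
apply: big1 => b _; rewrite cycles_add_rung; last exact: ladder_wf.
by apply/eqP; rewrite eqb0; apply/eqP; lia.
Qed.

(** At w' face tracing is a product in S_3 of the state with a 3-cycle: a reflection gives a
    reflection, the identity a 3-cycle, and a 3-cycle either a 3-cycle or the identity. *)
Lemma count_faces0 t c :
  count_faces 0 t c =
  match t with
  | inl _ => 2 * (c == 2)
  | inr None => 2 * (c == 1)
  | inr (Some _) => (c == 1) + (c == 3)
  end.
Proof.
have F b : cycles (face_map (N := end_net b) (state_fun t)) +
    nontrivial slots (face_map (N := end_net b) (state_fun t)) = 3.
  apply: cycles_slot.
    by apply: (@face_map_inj (end_net b) _ (@ladder_wf 0 b)); apply: state_fun_inj.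
  by move=> s; case: t b s => [[[]|]|[[]|]] [] [[]|]; lazy.
have K b : cycles (face_map (N := end_net b) (state_fun t)) =
    match t with inl _ => 2 | inr None => 1
               | inr (Some c) => if b == c then 1 else 3 end.
  apply: (@addIn (nontrivial slots (face_map (N := end_net b) (state_fun t)))).
  by rewrite F; case: t b {F} => [[[]|]|[[]|]] []; lazy.
rewrite /count_faces big_bool /= !K.
by case: t {F K} => [_|[[]|]] //=; rewrite !(eq_sym _ c); lia.
Qed.

Lemma shifted0 f c : shifted 0 f c = f c.
Proof. by rewrite /shifted subn0. Qed.

Lemma count_faces_id m c :
  count_faces m.+1 (inr None) c = 4 * count_faces m (inl None) c.
Proof. by rewrite count_facesS !big_bool /= !shifted0; lia. Qed.

Lemma count_faces_mirrorN m c :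
  count_faces m.+1 (inl None) c =
  2 * count_faces m (inr None) c + 2 * shifted 1 (count_faces m (inl None)) c.
Proof. by rewrite count_facesS !big_bool /= !shifted0; lia. Qed.

Lemma count_faces_mirror m s c :
  count_faces m.+1 (inl (Some s)) c =
  2 * count_faces m (inr (Some true)) c + 2 * count_faces m (inr (Some false)) c.
Proof.
by case: s; rewrite count_facesS !big_bool /= !shifted0; lia.
Qed.

Lemma count_faces_turn m s c :
  count_faces m.+1 (inr (Some s)) c =
  shifted 1 (count_faces m (inr (Some s))) c + count_faces m (inl None) c +
  count_faces m (inl (Some true)) c + count_faces m (inl (Some false)) c.
Proof.
by case: s; rewrite count_facesS !big_bool /= !shifted0 eqxx
  -?[true == false]/false -?[false == true]/false ?eqxx; lia.
Qed.

(** Reversing all rotations exchanges the two 3-cycles; the symmetry is read off the recursion. *)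
Lemma count_faces_turn_sym m c :
  count_faces m (inr (Some true)) c = count_faces m (inr (Some false)) c.
Proof.
elim: m c => [|m IH] c; first by rewrite !count_faces0.
rewrite !count_faces_turn /shifted; case: ifP => // _; by rewrite IH.
Qed.

Lemma count_faces_mirrorN_rec m c :
  count_faces m.+2 (inl None) c =
  8 * count_faces m (inl None) c + 2 * shifted 1 (count_faces m.+1 (inl None)) c.
Proof. by rewrite count_faces_mirrorN count_faces_id; lia. Qed.

Lemma count_faces_turn_rec m s c :
  count_faces m.+2 (inr (Some s)) c =
  shifted 1 (count_faces m.+1 (inr (Some s))) c + count_faces m.+1 (inl None) c +
  8 * count_faces m (inr (Some s)) c.
Proof.
rewrite count_faces_turn !count_faces_mirror count_faces_turn_sym.
by case: s; rewrite ?count_faces_turn_sym; lia.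
Qed.

(** The states [inl None] and [inr None] only lead to each other, so their recursion is closed; up
    to powers of 2 its coefficients obey [lucas_coefS]. *)
Lemma count_faces_mirrorN_closed m c :
  (m + 2 < c -> count_faces m (inl None) c = 0) /\
  forall j, c + j.*2 = m + 2 ->
    count_faces m (inl None) c = 2 ^ (m + j) * lucas_coef m j.
Proof.
have [k] := ubnP m; elim: k m c => // k IH [|[|m]] c mk.
- rewrite count_faces0; split=> [|j cj]; first by case: eqP => //; lia.
  case: j cj => [|j] cj; first by have -> : c = 2 by lia.
  by rewrite lucas_coef_small ?muln0; last lia; case: eqP => //; lia.
- rewrite count_faces_mirrorN /shifted !count_faces0.
  split=> [|j cj]; first by case: ifP; lia.
  case: j cj => [|[|j]] cj; first by have -> : c = 3 by lia.
    by have -> : c = 1 by lia.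
  lia.
have IH0 d := IH m d ltac:(lia); have IH1 d := IH m.+1 d ltac:(lia).
rewrite count_faces_mirrorN_rec /shifted; split=> [mc|j cj].
  rewrite (IH0 c).1; last by lia.
  by case: ifP => // c0; rewrite (IH1 (c - 1)).1 //; lia.
case: j cj => [|j] cj.
  rewrite (IH0 c).1; last by lia.
  case: ifP => [c0|]; last by lia.
  rewrite ((IH1 (c - 1)).2 0); last by lia.
  by rewrite !lucas_coef0 !addSn !expnS; lia.
rewrite ((IH0 c).2 j); last by lia.
rewrite lucas_coefS !addnS !addSn !expnS.
case: ifP => c0.
  rewrite ((IH1 (c - 1)).2 j.+1); last by lia.
  by rewrite !addnS !addSn !expnS; move: (2 ^ _) (lucas_coef _ _) (lucas_coef _ _); nia.
(* For c = 0 the shifted term is absent, and the coefficient it would match vanishes because 2(j+1)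
   = m + 4. *)
rewrite [lucas_coef m.+1 _]lucas_coef_small; last by lia.
by lia.
Qed.

(** The two 3-cycles are the rotations at w, hence the factor 2; c + 2j = m + 3 is Euler's formula
    for genus j. *)
Lemma count_faces_turn_closed m s c :
  (m + 3 < c -> count_faces m (inr (Some s)) c = 0) /\
  forall j, c + j.*2 = m + 3 ->
    2 * count_faces m (inr (Some s)) c = RL_genus m j.
Proof.
have [k] := ubnP m; elim: k m c => // k IH [|[|m]] c mk.
- rewrite count_faces0; split=> [|j cj]; first by do 2! case: eqP; lia.
  case: j cj => [|[|j]] cj; try by [have -> : c = 3 by lia | have -> : c = 1 by lia].
  by rewrite RL_genus_eq0; lia.
- rewrite count_faces_turn /shifted !count_faces0.
  split=> [|j cj]; first by case: ifP; lia.
  case: j cj => [|[|[|j]]] cj; last by lia.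
  + have -> : c = 4 by lia.
    by [].
  + have -> : c = 2 by lia.
    by [].
  + have -> : c = 0 by lia.
    by [].
have IH0 d := IH m d ltac:(lia); have IH1 d := IH m.+1 d ltac:(lia).
have [M0 M1] := count_faces_mirrorN_closed m.+1 c.
rewrite count_faces_turn_rec /shifted; split=> [mc|j cj].
  rewrite (IH0 c).1 ?M0; try lia.
  by case: ifP => // c0; rewrite (IH1 (c - 1)).1 //; lia.
case: j cj => [|j] cj.
  rewrite (IH0 c).1 ?M0; try lia.
  case: ifP => [c0|]; last by lia.
  by rewrite !addn0 ((IH1 (c - 1)).2 0) //; lia.
rewrite RL_genus_rec -((IH0 c).2 j); last by lia.
rewrite (M1 j); last by lia.
rewrite 2!mulnDr; congr (_ + _ + _); last by rewrite mulnCA.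
  case: ifP => c0; first by rewrite ((IH1 (c - 1)).2 j.+1) //; lia.
  by rewrite RL_genus_eq0 //; lia.
by rewrite mulnA -expnS.
Qed.

(** * Rotation systems of a cubic graph *)

(** The darts over an edge are some d and [flip d], distinct because there are no loops. *)
Lemma handshake (G : sgraph) : 2 * #|edges G| = #|dart G|.
Proof.
pose ends (d : dart G) : {set G} := [set (val d).1; (val d).2].
have -> : edges G = ends @: [set: dart G].
  apply/setP => e; apply/imsetP/imsetP => [[p pG ->]|[d _ ->]].
    have pa : adj p.1 p.2 by rewrite inE in pG.
    by exists (exist (fun p : G * G => adj p.1 p.2) p pa).
  by exists (val d); rewrite ?inE ?(valP d).
rewrite -sum1_card -[RHS]cardsT -sum1_card big_distrr /=.
rewrite [RHS](partition_big_imset ends) /=; apply: eq_bigr => e.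
case/imsetP => d _ ->; rewrite sum1dep_card muln1.
have -> : [set x in setT | ends x == ends d] = [set d; flip d].
  apply/setP => x; rewrite !inE /=; apply/eqP/orP => [E|]; last first.
    by case=> /eqP-> //; rewrite /ends /= setUC.
  have xne : (val x).1 != (val x).2.
    by apply/eqP => e1; have := valP x; rewrite /= e1 adj_irrefl.
  have := set21 (val x).1 (val x).2; have := set22 (val x).1 (val x).2.
  rewrite -/(ends x) E !inE => /orP[/eqP e2|/eqP e2] /orP[/eqP e1|/eqP e1].
  - by rewrite e1 e2 eqxx in xne.
  - right; apply/eqP/val_inj; rewrite /= -e1 -e2; exact: surjective_pairing.
  - left; apply/eqP/val_inj; rewrite [RHS]surjective_pairing -e1 -e2.
    exact: surjective_pairing.
  - by rewrite e1 e2 eqxx in xne.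
rewrite cards2; case: eqP => // /(congr1 (fun d => (val d).1)) /= e1.
by have := valP d; rewrite /= -e1 adj_irrefl.
Qed.

Lemma fixpoint_free_turn (f : slot -> slot) :
  injective f -> (forall s, f s != s) ->
  f =1 turn (f (Some false) == Some true).
Proof.
move=> fI fs.
have := fs None; have := fs (Some true); have := fs (Some false).
case E1: (f (Some false)) => [[]|] // _; case E2: (f (Some true)) => [[]|] // _;
  case E3: (f None) => [[]|] // _; try by case=> [[]|].
all: by move: (fI (Some false) (Some true)) (fI None (Some true))
  (fI None (Some false)); rewrite E1 E2 E3 => h1 h2 h3;
  first [have := h1 erefl | have := h2 erefl | have := h3 erefl].
Qed.

Lemma turn_transitive b s s' : exists i, s' = iter i (turn b) s.
Proof.
by case: b s s' => -[[]|] [[]|];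
  first [by exists 0 | by exists 1 | by exists 2].
Qed.

Section Cubic.
Variables (G : sgraph) (mk : G * slot -> dart G) (ix : dart G -> G * slot).
Hypotheses (mkK : cancel mk ix) (ixK : cancel ix mk).
Hypothesis tail_mk : forall x, tail (mk x) = x.1.

Definition turn_dart (b : {ffun G -> bool}) (d : dart G) : dart G :=
  mk ((ix d).1, turn (b (ix d).1) (ix d).2).

Lemma turn_dart_inj b : injective (turn_dart b).
Proof.
move=> d1 d2 /(can_inj mkK) [e1]; rewrite e1 => /turn_inj e2.
by rewrite -[d1]ixK -[d2]ixK [ix d1]surjective_pairing e1 e2 -surjective_pairing.
Qed.

Definition bit_rotation b : {perm dart G} := perm (@turn_dart_inj b).

Lemma tail_ix d : tail d = (ix d).1.
Proof. by rewrite -{1}[d]ixK tail_mk. Qed.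

Lemma bit_rotationE b v s : bit_rotation b (mk (v, s)) = mk (v, turn (b v) s).
Proof. by rewrite permE /turn_dart mkK. Qed.

Lemma bit_rotationP b : rotation_system (bit_rotation b).
Proof.
apply/forallP => d; apply/eqP/setP => d'; rewrite inE; apply/idP/eqP.
  case/porbitP => i ->; elim: i => [|i IH]; first by rewrite perm1.
  by rewrite expgSr permM permE /turn_dart tail_mk -tail_ix.
rewrite -[d]ixK -[d']ixK; case: (ix d) (ix d') => [v s] [v' s'].
rewrite !tail_mk /= => ->.
have h i : (bit_rotation b ^+ i)%g (mk (v, s)) = mk (v, iter i (turn (b v)) s).
  elim: i => [|i IH]; first by rewrite perm1.
  by rewrite expgSr permM IH bit_rotationE.
have [i ->] := turn_transitive (b v) s s'.
by rewrite -h mem_porbit.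
Qed.

(** At each vertex R permutes the three slots without fixed points, hence as one of the two
    3-cycles. *)
Lemma rotation_system_bits (R : {perm dart G}) :
  rotation_system R -> exists b, R = bit_rotation b.
Proof.
move/forallP => RS.
have tR d : tail (R d) = tail d.
  have := mem_porbit R 1 d; rewrite expg1 (eqP (RS d)) inE.
  by move/eqP.
pose f v s := (ix (R (mk (v, s)))).2.
have fE v s : R (mk (v, s)) = mk (v, f v s).
  rewrite -[LHS]ixK [ix _]surjective_pairing; congr (mk (_, _)).
  by rewrite -tail_ix tR tail_mk.
have fI v : injective (f v).
  by move=> s s' e; have : R (mk (v, s)) = R (mk (v, s'));
    [rewrite !fE e | move/perm_inj/(can_inj mkK) => -[]].
(* A fixed dart would be a whole cycle of R, which must contain the other darts at v too. *)
have fs v s : f v s != s.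
  apply/eqP => e; have Rd : R (mk (v, s)) = mk (v, s) by rewrite fE e.
  have := RS (mk (v, s)); move/eqP/setP/(_ (mk (v, turn true s))).
  rewrite inE !tail_mk eqxx => /porbitP[i].
  have -> : (R ^+ i)%g (mk (v, s)) = mk (v, s).
    by elim: i => [|i IH]; rewrite ?perm1 // expgSr permM IH.
  by move/(can_inj mkK) => -[]; case: s {e Rd} => [[]|].
exists [ffun v => f v (Some false) == Some true]; apply/permP => d.
rewrite -[d]ixK; case: (ix d) => v s.
by rewrite bit_rotationE fE ffunE -fixpoint_free_turn.
Qed.

Lemma bit_rotation_inj : injective bit_rotation.
Proof.
move=> b b' e; apply/ffunP => v.
have := congr1 (fun R : {perm dart G} => R (mk (v, None))) e.
by rewrite /= !bit_rotationE => /(can_inj mkK) [] /(can_inj negbK).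
Qed.

Lemma card_rotation_systems (P : pred {perm dart G}) :
  #|[set R | rotation_system R && P R]| = #|[set b | P (bit_rotation b)]|.
Proof.
rewrite -(card_imset _ bit_rotation_inj); congr #|pred_of_set _|.
apply/setP => R; rewrite inE; apply/andP/imsetP => [[/rotation_system_bits[b ->]]|].
  by move=> Pb; exists b; rewrite ?inE.
by case=> b; rewrite inE => Pb ->; rewrite bit_rotationP.
Qed.

Lemma card_dart_cubic : #|dart G| = 3 * #|G|.
Proof.
by rewrite (bij_eq_card (Bijective ixK mkK)) card_prod card_option card_bool mulnC.
Qed.
End Cubic.

(** * The Ringel ladder *)

Section RingelLadder.
Variable k : nat.
Local Notation n := k.+1.
Local Notation V := (RL_vertex n).
Local Notation E := (V * slot)%type.

(** Positions are natural numbers, so neighbouring ones need no casts; [inord] gives the intended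
    vertex only for j < n. *)
Definition rail (s : bool) (j : nat) : V :=
  if s then RL_v (inord j) else RL_u (inord j).

(* The two darts of the edge of rail [s] between positions [j - 1] and [j],
   where the rungs are [0, ..., n - 1] and the ends are w and w'. *)
Definition left_flip (s : bool) (j : nat) : E :=
  if j is i.+1 then (rail s i, Some true) else (RL_w, Some s).

Definition right_flip (s : bool) (j : nat) : E :=
  if j < n then (rail s j, Some false) else (RL_w', Some s).

Definition RL_flip (x : E) : E :=
  match x with
  | (RL_u i, None) => (RL_v i, None)
  | (RL_v i, None) => (RL_u i, None)
  | (RL_u i, Some false) => left_flip false i
  | (RL_u i, Some true) => right_flip false i.+1
  | (RL_v i, Some false) => left_flip true i
  | (RL_v i, Some true) => right_flip true i.+1
  | (RL_w, Some s) => right_flip s 0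
  | (RL_w', Some s) => left_flip s n
  | (inr b, None) => (inr (~~ b), None)
  end.

Lemma rail_eq s s' i j : i < n -> j < n -> rail s i = rail s' j -> s = s' /\ i = j.
Proof.
move=> iN jN; case: s; case: s' => //= -[] /(congr1 val) /=;
  by rewrite !inordK.
Qed.

Lemma railP (x : V) : (exists s i, i < n /\ x = rail s i) \/ exists b, x = inr b.
Proof.
case: x => [[i|i]|b]; last by right; exists b.
  by left; exists false, i; rewrite /rail inord_val.
by left; exists true, i; rewrite /rail inord_val.
Qed.

Lemma RL_flip_rung s j : RL_flip (rail s j, None) = (rail (~~ s) j, None).
Proof. by case: s. Qed.

Lemma RL_flip_railR s j : j < n ->
  RL_flip (rail s j, Some true) = right_flip s j.+1.
Proof. by move=> jn; case: s; rewrite /= inordK. Qed.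

Lemma RL_flip_railL s j : j < n ->
  RL_flip (rail s j, Some false) = left_flip s j.
Proof. by move=> jn; case: s; rewrite /= inordK. Qed.

Lemma RL_flip_right s j : j <= n -> RL_flip (right_flip s j) = left_flip s j.
Proof.
move=> jn; rewrite /right_flip; case: ifP => [|jn']; first exact: RL_flip_railL.
by have -> : j = n by lia.
Qed.

Lemma RL_flip_left s j : j <= n -> RL_flip (left_flip s j) = right_flip s j.
Proof. by case: j => [|j] jn //; apply: RL_flip_railR. Qed.

Lemma RL_flipK : involutive RL_flip.
Proof.
case=> x s; case: (railP x) => [[c [i [iN ->]]]|[b ->]].
  case: s => [[]|].
  - by rewrite RL_flip_railR // RL_flip_right.
  - by rewrite RL_flip_railL // RL_flip_left ?(ltnW iN) // /right_flip iN.
  - by rewrite !RL_flip_rung negbK.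
case: s => [s|]; last by case: b.
case: b.
  have -> : RL_flip (RL_w', Some s) = left_flip s n by [].
  by rewrite RL_flip_left // /right_flip ltnn.
have -> : RL_flip (RL_w, Some s) = right_flip s 0 by [].
by rewrite RL_flip_right.
Qed.

Lemma RL_edge_flip (x y : V) :
  RL_edge x y -> exists s s', RL_flip (x, s) = (y, s').
Proof.
have L (i j : 'I_n) : i.+1 = j -> right_flip false i.+1 = (RL_u j, Some false) /\
    right_flip true i.+1 = (RL_v j, Some false).
  by move=> e; rewrite /right_flip e ltn_ord /= inord_val.
have W (i : 'I_n) : i = 0 :> nat -> right_flip false 0 = (RL_u i, Some false) /\
    right_flip true 0 = (RL_v i, Some false).
  by move=> e; rewrite /right_flip -e ltn_ord /= inord_val.
have W' (i : 'I_n) : i.+1 = n -> left_flip false n = (RL_u i, Some true) /\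
    left_flip true n = (RL_v i, Some true).
  move=> [e]; have ek : inord k = i by apply: val_inj; rewrite /= inordK.
  by rewrite /= ek.
case: x y => [[i|i]|[]] [[j|j]|[]] //=; try move/eqP => e.
- by exists (Some true), (Some false); case: (L i j e).
- by exists None, None; rewrite e.
- by exists (Some true), (Some false); case: (L i j e).
- by exists (Some false), (Some true); case: (W' j e).
- by exists (Some true), (Some true); case: (W' j e).
- by exists (Some false), (Some false); case: (W j e).
- by exists (Some true), (Some false); case: (W j e).
- by exists None, None.
Qed.

Lemma RL_flip_adj (x : E) : RL_adj x.1 (RL_flip x).1.
Proof.
have rR s j : j < n -> RL_adj (rail s j) (right_flip s j.+1).1.
  move=> jn; rewrite /right_flip; case: ifP => jn'; case: s;
    rewrite /RL_adj /= !inordK //; lia.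
have wR s : RL_adj RL_w (right_flip s 0).1.
  by case: s; rewrite /RL_adj /= inordK.
have rL s j : j < n -> RL_adj (rail s j) (left_flip s j).1.
  case: j => [|j] jn; first by rewrite RL_adj_sym; apply: wR.
  rewrite RL_adj_sym; have := rR s j (ltnW jn).
  by rewrite /right_flip jn.
case: x => x s; case: (railP x) => [[c [i [iN ->]]]|[b ->]].
  case: s => [[]|].
  - by rewrite RL_flip_railR //; apply: rR.
  - by rewrite RL_flip_railL //; apply: rL.
  - by rewrite RL_flip_rung; case: c; rewrite /RL_adj /= eqxx ?orbT.
case: s => [s|]; last by case: b.
case: b; last exact: wR.
rewrite [RL_flip _]/(left_flip s n) /= RL_adj_sym.
by have := rR s k (ltnSn k); rewrite /right_flip ltnn.
Qed.

Lemma RL_neighbour_inj (x : V) : injective (fun s => (RL_flip (x, s)).1).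
Proof.
have [[c [i [iN ->]]]|[b ->]] := railP x.
  (* The column of a vertex, with w in column 0: the neighbours of a vertex of rung i lie in the
     distinct columns i, i + 1 and i + 2. *)
  pose pos (v : V) : nat :=
    match v with RL_u j | RL_v j => j.+1 | RL_w => 0 | RL_w' => n.+1 end.
  have pr t j : j < n -> pos (rail t j) = j.+1.
    by move=> jn; case: t; rewrite /= inordK.
  have pF s : pos (RL_flip (rail c i, s)).1 =
      match s with Some true => i.+2 | Some false => i | None => i.+1 end.
    case: s => [[]|]; rewrite ?RL_flip_railR ?RL_flip_railL ?RL_flip_rung //.
    - by rewrite /right_flip; case: ifP => h; [apply: pr | rewrite /=; lia].
    - by case: i iN => [|i] iN //=; apply/pr/ltnW.
    - exact: pr.
  move=> s s' /(congr1 pos); rewrite !pF.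
  by case: s => [[]|]; case: s' => [[]|] //; lia.
by case: b => -[[]|] [[]|].
Qed.

Lemma RL_neighbour_surj (x y : V) : RL_adj x y -> exists s, (RL_flip (x, s)).1 = y.
Proof.
case/orP => /RL_edge_flip [s [s' e]]; first by exists s; rewrite e.
by exists s'; rewrite -e RL_flipK.
Qed.

Definition RL_dart (x : E) : dart (ringel_ladder n) :=
  exist (fun p : V * V => RL_adj p.1 p.2) (x.1, (RL_flip x).1) (RL_flip_adj x).

Lemma RL_dart_bij : bijective RL_dart.
Proof.
have dI : injective RL_dart.
  move=> [x s] [y s'] /(congr1 val) /= [<-] e.
  by congr pair; apply: (@RL_neighbour_inj x).
have ds (d : dart (ringel_ladder n)) : exists x, RL_dart x == d.
  have [s e] := RL_neighbour_surj (valP d).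
  exists ((val d).1, s); apply/eqP/val_inj; rewrite [RHS]surjective_pairing /=.
  by rewrite e.
exists (fun d => xchoose (ds d)) => [x|d]; last exact/eqP/(xchooseP (ds d)).
by apply: dI; apply/eqP/(xchooseP (ds _)).
Qed.

Lemma flip_RL_dart x : flip (RL_dart x) = RL_dart (RL_flip x).
Proof. by apply: val_inj; rewrite /= RL_flipK. Qed.

Definition RL_face (b : {ffun V -> bool}) (x : E) : E :=
  ((RL_flip x).1, turn (b (RL_flip x).1) (RL_flip x).2).

Lemma card_RL_vertex : #|V| = 2 * n + 2.
Proof. by rewrite !card_sum card_ord card_bool; lia. Qed.

(** With V = 2n + 2 and E = 3n + 3, Euler's formula becomes F + 2i = n + 3. *)
Lemma genus_count_bits i :
  genus_count (ringel_ladder n) i =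
  #|[set b : {ffun V -> bool} | cycles (RL_face b) + 2 * i == n + 3]|.
Proof.
case: RL_dart_bij => ix mkK ixK.
have tail_mk (x : E) : tail (RL_dart x) = x.1 by [].
rewrite /genus_count (card_rotation_systems mkK ixK tail_mk).
congr #|pred_of_set _|; apply/setP => b; rewrite !inE /has_genus.
have -> : faces (bit_rotation mkK ixK b) = cycles (RL_face b).
  rewrite /faces cycles_perm; apply/esym/(cycles_conj (Bijective mkK ixK)).
  move=> x; rewrite permM permE flip_RL_dart [RL_flip x]surjective_pairing.
  by rewrite bit_rotationE /RL_face.
have := handshake (ringel_ladder n).
rewrite (card_dart_cubic mkK ixK) [#|ringel_ladder n|]card_RL_vertex => e.
by apply/eqP/eqP; lia.
Qed.
End RingelLadder.

(* [N] with w glued to its three cut edges. *)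
Definition attach_face (N : network) (b : bool) (d : slot + N) : slot + N :=
  match d with
  | inl p => inr (nrot (port N p))
  | inr d => match out d with inl p => inl (turn b p) | inr d' => inr (nrot d') end
  end.

(** Each of the three darts at w is bypassed nontrivially, so no face closes: w alone is an absorbed
    part in the state [turn b]. *)
Lemma cycles_attach (N : network) b : injective (attach_face (N := N) b) ->
  cycles (attach_face (N := N) b) = cycles (face_map (N := N) (turn b)).
Proof.
case: N => N pN oN rN fI; set f := attach_face b in fI *.
pose l : seq (slot + N) := [seq inl s | s <- slots].
have cA a : foldl (fun f x => bypass x f) f l (inl a) = inl a.
  by rewrite /f; case: b {fI f} a => -[[]|]; lazy.
have cN (d : N) : foldl (fun f x => bypass x f) f l (inr d) =
    inr (face_map (N := Network pN oN rN) (turn b) d).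
  by rewrite /f; case: b {fI f cA}; lazy; case: (oN d) => [[[]|]|d'].
have := cycles_foldl_bypass l fI.
rewrite (cycles_sum cA cN) card_option card_bool.
have -> : nontrivial l f = 3 by rewrite /f; case: b {fI f cA cN}; lazy.
by rewrite addnC => /addIn.
Qed.

Lemma card_ladder m (b : bits m) : #|ladder b| = 6 * m + 3.
Proof.
elim: m b => [|m IH] b; first by rewrite card_option card_bool.
by rewrite [LHS]card_sum IH card_prod card_option card_bool; lia.
Qed.

(** * The Ringel ladder as a chain of absorbed rungs *)

Section Embedding.
Variable k : nat.
Local Notation n := k.+1.
Local Notation V := (RL_vertex n).
Local Notation E := (V * slot)%type.
Variable b : {ffun V -> bool}.

(* The bits at w' and at the last [m] rungs. *)
Fixpoint read_bits (m : nat) : bits m :=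
  if m is m'.+1 return bits m then
    ((b (rail k false (n - m)), b (rail k true (n - m))), read_bits m')
  else b RL_w'.

Definition port_dart (j : nat) (p : slot) : E :=
  if p is Some s then right_flip k s j else (RL_w', None).

Definition beyond (j : nat) (x : V) : bool :=
  match x with RL_u i | RL_v i => j <= i | inr c => c end.

(** Induction on m adds the rung at position n - m - 1 on the left; [beyond] keeps its darts apart
    from those already placed. *)
Lemma ladder_embedding m : m <= n ->
  exists h : ladder (read_bits m) -> E,
    [/\ injective h,
        forall d, beyond (n - m) (h d).1,
        forall d, h (nrot d) = ((h d).1, turn (b (h d).1) (h d).2),
        forall d d', out d = inr d' -> RL_flip (h d) = h d'
      & forall p, h (port _ p) = port_dart (n - m) p].
Proof.
elim: m => [|m IH] mn.
  exists (fun s => (RL_w', s)); split=> //; first by move=> s s' [].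
  by case=> [s|] //; rewrite subn0 /port_dart /right_flip ltnn.
have [h [hI hB hR hO hP]] := IH (ltnW mn).
have [_ op _ _] := ladder_wf (read_bits m).
have jn : n - m.+1 < n by lia.
set j := n - m.+1 in jn *; have ej : n - m = j.+1 by lia.
rewrite ej in hB hP.
pose g (d : ladder (read_bits m.+1)) : E :=
  match d with inl (s, t) => (rail k s j, t) | inr d => h d end.
have bj s t d : (rail k s j, t) <> h d.
  by move=> e; have := hB d; rewrite -e; case: s {e} => /=; rewrite inordK // ltnn.
exists g; split.
- move=> [[s t]|d] [[s' t']|d'] //=.
  + by move=> [/(rail_eq jn jn)[-> _] ->].
  + by move/bj.
  + by move/esym/bj.
  + by move/hI => ->.
- move=> [[s t]|d] /=; first by case: s; rewrite /= inordK.
  by have := hB d; case: (h d).1 => [[i|i]|c] //=; apply: ltnW.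
- by move=> [[s t]|d]; [case: s | apply: hR].
- move=> [[s [[]|]]|d] d'.
  + by move=> [<-]; rewrite [LHS]RL_flip_railR //; exact: esym (hP (Some s)).
  + by [].
  + by move=> [<-]; rewrite [LHS]RL_flip_rung.
  + rewrite /=; case D: (out d) => [[s|]|e] //= [<-] /=; last exact: hO.
    by rewrite (op _ _ D) hP RL_flip_right.
- case=> [s|] /=; last by rewrite hP.
  by rewrite /right_flip jn.
Qed.

Lemma cycles_RL_face :
  cycles (RL_face b) =
  cycles (face_map (N := ladder (read_bits n)) (turn (b RL_w))).
Proof.
have [h [hI hB hR hO hP]] := ladder_embedding (leqnn n).
have [_ op _ _] := ladder_wf (read_bits n).
move: (card_ladder (read_bits n)) h hI hB hR hO hP op.
move: (ladder (read_bits n)) => N cN h hI hB hR hO hP op.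
rewrite subnn in hB hP.
pose g (d : (slot + N)%type) : E :=
  match d with inl s => (RL_w, s) | inr d => h d end.
have gI : injective g.
  move=> [s|d] [s'|d'] //=.
  - by move=> [->].
  - by move=> e; have := hB d'; rewrite -e.
  - by move=> e; have := hB d; rewrite e.
  - by move/hI => ->.
(* Both sides have 6n + 6 elements, so injectivity suffices. *)
have gb : bijective g.
  apply: inj_card_bij gI _; rewrite card_prod [leqRHS]card_sum card_RL_vertex.
  by rewrite cN card_option card_bool; lia.
have gF d : g (attach_face (b RL_w) d) = RL_face b (g d).
  have fp p : RL_flip (port_dart 0 p) = (RL_w, p).
    by case: p => [s|] //; rewrite /port_dart RL_flip_right.
  case: d => [p|d] /=.
    rewrite hR hP /RL_face.
    suff -> : RL_flip (RL_w, p) = port_dart 0 p by [].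
    by rewrite -fp RL_flipK.
  case D: (out d) => [p|d'] /=; rewrite /RL_face; last by rewrite hR (hO _ _ D).
  by rewrite (op _ _ D) hP fp.
rewrite -(cycles_conj gb gF) cycles_attach //.
move=> d d' /(congr1 g); rewrite !gF => -[e1].
rewrite e1 => /turn_inj e2; apply/gI/(inv_inj (@RL_flipK k)).
by rewrite [LHS]surjective_pairing e1 e2 -surjective_pairing.
Qed.

End Embedding.

(** * From bit vectors to the genus distribution *)

Lemma card_bits m : #|bits m| = 2 ^ m.*2.+1.
Proof.
elim: m => [|m IH]; first by rewrite card_bool.
by rewrite [LHS]card_prod IH card_prod card_bool doubleS !expnS !mulnA.
Qed.

Lemma read_bits_eq k (b b' : {ffun RL_vertex k.+1 -> bool}) m : m <= k.+1 ->
  read_bits b m = read_bits b' m ->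
  b RL_w' = b' RL_w' /\
  forall s j, k.+1 - m <= j < k.+1 -> b (rail k s j) = b' (rail k s j).
Proof.
elim: m => [|m IH] mk.
  by move=> e; split=> // s j; rewrite subn0 => /andP[h1 h2]; lia.
move=> [eu ev e]; have [ew er] := IH (ltnW mk) e; split=> // s j hj.
have [ej|nj] := eqVneq j (k.+1 - m.+1); first by rewrite ej; case: s.
by apply: er; lia.
Qed.

Lemma read_bits_bij k : bijective (fun b : {ffun RL_vertex k.+1 -> bool} =>
  (b RL_w, read_bits b k.+1)).
Proof.
apply: inj_card_bij => [b b' e2|].
  have [ew er] : b RL_w = b' RL_w /\ read_bits b k.+1 = read_bits b' k.+1.
    by split; [apply: (congr1 fst e2) | apply: (congr1 snd e2)].
  have [ew' e] := read_bits_eq (leqnn _) er; apply/ffunP => x.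
  have [[s [j [jn ->]]]|[[] ->]] //  := railP x.
  by apply: e; rewrite subnn.
rewrite card_prod card_bits card_bool -expnS card_ffun card_bool card_RL_vertex.
by rewrite leq_exp2l //; lia.
Qed.

(** The sum splits by the bit at w, and each of the two halves equals half of [RL_genus]. *)
Lemma genus_countE n i : 1 <= n -> genus_count (ringel_ladder n) i = RL_genus n i.
Proof.
case: n => // k _; set n := k.+1; rewrite genus_count_bits.
pose ok (x : bool * bits n) :=
  cycles (face_map (N := ladder x.2) (turn x.1)) + 2 * i == n + 3.
have -> : #|[set b : {ffun RL_vertex n -> bool} |
    cycles (RL_face b) + 2 * i == n + 3]| = #|[set x | ok x]|.
  rewrite -(on_card_preimset (onW_bij _ (read_bits_bij k))).
  by apply: eq_card => b; rewrite !inE /ok cycles_RL_face.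
rewrite -sum1dep_card big_mkcond /=.
rewrite (eq_bigr (fun x => if ok (x.1, x.2) then 1 else 0)) => [|[]//].
rewrite -(pair_bigA _ (fun c x => if ok (c, x) then 1 else 0)) big_bool /=.
(* Beyond this bound n + 3 - 2i would truncate, but then both sides are 0. *)
have [ni|ni] := leqP i.*2 (n + 3).
  have F c : 2 * \sum_(x : bits n) (if ok (c, x) then 1 else 0) = RL_genus n i.
    have [_ <-] := count_faces_turn_closed n c (n + 3 - i.*2); last by lia.
    congr (2 * _); apply: eq_bigr => x _; rewrite /ok /=.
    by case: eqP => h1; case: eqP => h2 //=; exfalso; lia.
  by apply: double_inj; rewrite -mul2n mulnDr !F addnn.
rewrite RL_genus_eq0; last by lia.
by rewrite !big1 // => x _; rewrite /ok; case: eqP => // h; exfalso; lia.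
Qed.

Lemma eq_unimodal_at (a a' : nat -> nat) q n l m : a =1 a' ->
  unimodal_at a q n l m -> unimodal_at a' q n l m.
Proof.
move=> e [h1 [h2 [h3 h4 h5 h6 h7]]]; split=> //; split=> //.
by split=> *; rewrite -!e; auto.
Qed.

Theorem corollary4p7 (n : nat) (hn : 1 <= n) :
  exists q r : nat,
    [/\ is_min_genus (ringel_ladder n) q,
        is_max_genus (ringel_ladder n) r,
        unimodal (genus_count (ringel_ladder n)) q r
      & is_peak (genus_count (ringel_ladder n)) q r (p_RL n)].
Proof.
have gE i := genus_countE i hn.
have peak : is_peak (genus_count (ringel_ladder n)) 0 ((n + 2) %/ 2) (p_RL n).
  by apply: eq_unimodal_at (RL_genus_unimodal n hn) => i; rewrite gE.
exists 0, ((n + 2) %/ 2); split=> //; last by exists (p_RL n), (p_RL n).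
  by split=> //; rewrite gE /RL_genus lucas_coef0.
split=> [|i]; rewrite gE; first exact: RL_genus_max_gt0.
by apply: contraLR; rewrite -ltnNge -eqn0Ngt => /RL_genus_eq0 ->.
Qed.
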